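(* For every real $\eta>0$ there exists an integer $K=K(\eta)$ (depending only on $\eta$) such that, for every integer $k\ge K$ and every integer $n>k+1$, writing $\nu=\frac{n}{k+1}$, \[ \left|\frac{M(n,k)}{\nu\log\log(k+1)}-\Phi(\nu)\right|<\eta . \]
   Context: All graphs are finite, simple and undirected; all logarithms are natural. For a connected graph $G$, a set $D\subseteq V(G)$ is a dominating set if every vertex of $V(G)\setminus D$ has a neighbor in $D$; it is a connected dominating set if moreover the induced subgraph $G[D]$ is connected. The domination number $\gamma(G)$ (respectively the connected domination number $\gamma_c(G)$) is the minimum cardinality of a dominating set (respectively connected dominating set) of $G$. For integers $n,k$ with $n-1\ge k>1$, $M(n,k)$ denotes the maximum of $\gamma_c(G)-\gamma(G)$ over all connected graphs $G$ with $n$ vertices and minimum degree at least $k$. For real $x>1$, $\Phi(x)=\dfrac{1}{x\log\frac{x}{x-1}}$. *)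

(* Defs.v *)
From mathcomp Require Import all_boot all_order all_algebra.
From mathcomp Require Import reals exp.

Set Implicit Arguments.
Unset Strict Implicit.
Unset Printing Implicit Defensive.

Import Order.TTheory GRing.Theory Num.Theory.

Section Graph.
Variables (T : finType) (e : rel T).

Definition simple_graph : bool :=
  [forall x, ~~ e x x] && [forall x, forall y, e x y == e y x].

Definition degree (x : T) : nat := #|[set y | e x y]|.

Definition min_degree_ge (k : nat) : bool := [forall x, k <= degree x].

Definition induced (D : {set T}) : rel T :=
  [rel x y | [&& x \in D, y \in D & e x y]].

Definition induced_connected (D : {set T}) : bool :=
  [forall x in D, forall y in D, connect (induced D) x y].

Definition connected_graph : bool := [forall x, forall y, connect e x y].

Definition dominating (D : {set T}) : bool :=
  [forall x in ~: D, exists y in D, e x y].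

Definition connected_dominating (D : {set T}) : bool :=
  dominating D && induced_connected D.

(* The default set [set: T] is dominating in every graph, and is connected
   dominating in every connected graph. *)
Definition domination_number : nat :=
  #|[arg min_(D < [set: T] | dominating D) #|D|]|.

(* Meaningful for connected graphs only. *)
Definition connected_domination_number : nat :=
  #|[arg min_(D < [set: T] | connected_dominating D) #|D|]|.

End Graph.

(* E ranges over all sets of ordered pairs; those passing simple_graph are the
   simple undirected graphs with vertex set 'I_n. *)
Definition edge_rel (T : finType) (E : {set T * T}) : rel T :=
  [rel x y | (x, y) \in E].

(* A connected dominating set is dominating, so in a connected graph the
   truncated subtraction below is the usual one. *)
Definition M (n k : nat) : nat :=
  \max_(E : {set 'I_n * 'I_n} | [&& simple_graph (edge_rel E),
                                    connected_graph (edge_rel E) &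
                                    min_degree_ge (edge_rel E) k])
    (connected_domination_number (edge_rel E) - domination_number (edge_rel E)).

Definition Phi (R : realType) (x : R) : R := (1 / (x * ln (x / (x - 1))))%R.

(* Main.v *)
Require Import Defs.
From mathcomp Require Import all_boot all_order all_algebra.
From mathcomp Require Import reals exp.
From mathcomp Require Import sequences ring lra.

(** Write d = k + 1, nu = n / d, L = ln d, y = ln L and
    psi nu = nu * Phi nu = 1 / ln (nu / (nu - 1)).  The claim is that M(n,k)
    differs from psi nu * y by less than eta * nu * y.

    Every closed neighbourhood has at least n / nu vertices, so by double
    counting some vertex dominates a fraction 1 / nu of any given set.  Taking
    such vertices greedily, t of them leave at most a fraction
    (1 - 1 / nu)^t = exp (- t / psi nu) undominated ([greedy_hitting],
    [greedy_remainder_le]).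

    Upper bound ([M_upper]).  Let D be a minimum dominating set; by greed
    |D| = O(nu L).  About psi nu * y greedy vertices S dominate all but a
    fraction 1 / L of D, that is, all but O(nu) of it.  About eps * nu * y
    further greedy vertices S1 dominate all but O(nu / eps) of S.  So the
    components of the graph induced on D, S and S1 together are represented by
    S1 and O(nu / eps) other vertices, and in a connected graph two new
    vertices suffice to merge two components of a dominating set
    ([connected_dominating_extension]).  Only |S| = psi nu * y is of leading
    order.

    Lower bound ([gadget], [M_lower]).  Take a large clique A and l blocks, and
    split a part of A into N equal types for each block.  A block has m
    centres, about L^(1 - eps / 2) of them; each centre is adjacent to all the
    vertices of all but a fraction q of the types.  These q N missed types are
    chosen so that any s types are all missed by a common centre; greed shows
    that this is possible for s close to ln L / ln (1 / q), although m is only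
    a power of L and N is only linear in m.  Each centre also has b satellites,
    b being about the square root of d, adjacent to it and to types chosen so
    that any m + s types are all missed by some satellite.  The l m centres
    and one clique vertex dominate.  A connected dominating set meets each
    block in at least m + s vertices: if it leaves out a centre, then only
    vertices other than centres can dominate the satellites of that centre,
    and m + s of them are too few; otherwise it contains m centres, which are
    pairwise non-adjacent, and it needs a neighbour for each of them, for
    which s vertices are too few.  Hence the difference is at least l s - 1,
    where the degree condition asks for 1 - q of about l / nu.  With l = 1 for
    bounded nu and l proportional to nu for large nu, l / ln (1 / q) is within
    eta * nu of psi nu, and all nu > 1 are served by finitely many rational
    values of q ([psi_blocks]), which gives uniformity in n. *)

Set Implicit Arguments.
Unset Strict Implicit.
Unset Printing Implicit Defensive.

Import Order.TTheory GRing.Theory Num.Theory.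
Local Open Scope ring_scope.

(** * Greedy hitting sets *)
Section Greedy.
Local Open Scope nat_scope.

(** By double counting, some element of [J] hits at least a fraction
    d / #|J| of the elements not hit so far.  The lemma serves twice: for
    dominating sets (vertices hit by closed neighbourhoods) and for covering
    families (small sets contained in larger ones). *)
Lemma greedy_hitting (I J : finType) (r : I -> J -> bool) (W : {set I})
    (d t : nat) :
  0 < #|J| -> (forall i, i \in W -> d <= #|[set j | r i j]|) ->
  exists2 S : seq J, size S = t &
    #|[set i in W | ~~ has (r i) S]| * #|J| ^ t <= #|W| * (#|J| - d) ^ t.
Proof.
move=> J0 Wd; elim: t => [|t [S szS leS]].
  by exists [::] => //; rewrite !expn0 !muln1 subset_leq_card //; apply/subsetP=> i; rewrite inE => /andP[].
set U := [set i in W | _] in leS.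
pose h j := #|[set i in U | r i j]|.
have sumh : #|U| * d <= \sum_j h j.
  have -> : \sum_j h j = \sum_(i in U) #|[set j | r i j]|.
    under eq_bigr => j _ do rewrite /h -sum1_card.
    under [RHS]eq_bigr => i _ do rewrite -sum1_card.
    rewrite (exchange_big_dep (mem U)) /=; last by move=> j i _; rewrite inE => /andP[].
    apply: eq_bigr => i iU; apply: eq_bigl => j; by rewrite !inE in iU *; rewrite iU.
  rewrite -sum_nat_const; apply: leq_sum => i; rewrite inE => /andP[iW _]; exact: Wd.
have [j jh] : exists j, #|U| * d <= #|J| * h j.
  have [j0 _] : exists j0 : J, j0 \in J by apply/card_gt0P.
  pose j := [arg max_(j > j0) h j].
  exists j; apply: leq_trans sumh _.
  rewrite -sum_nat_const; apply: leq_sum => i _.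
  rewrite /j; case: arg_maxnP => // j1 _; exact.
exists (j :: S); first by rewrite /= szS.
have cU : #|[set i in W | ~~ has (r i) (j :: S)]| = #|U| - h j.
  rewrite /h -cardsDS; last by apply/subsetP => i; rewrite inE => /andP[].
  apply: eq_card => i; rewrite !inE /= negb_or.
  by case: (i \in W); case: (r i j); case: (has (r i) S).
rewrite cU !expnS !mulnA.
apply: leq_trans (_ : #|U| * (#|J| - d) * #|J| ^ t <= _).
  rewrite leq_mul2r mulnBl mulnBr leq_sub2l ?orbT //.
  by rewrite [h j * _]mulnC.
by rewrite mulnAC [leqRHS]mulnAC leq_mul2r leS orbT.
Qed.
End Greedy.

(** * Connecting a dominating set, and the upper bound in the naturals *)
Section Components.
Local Open Scope nat_scope.
Variables (T : finType) (e : rel T).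
Hypothesis e_simple : simple_graph e.
Hypothesis e_conn : connected_graph e.

Lemma simple_sym : symmetric e.
Proof. by move: e_simple => /andP[_ /forallP s] x y; move/forallP/(_ y)/eqP: (s x). Qed.

Lemma simple_irr x : e x x = false.
Proof. by move: e_simple => /andP[/forallP/(_ x)/negbTE]. Qed.

Lemma induced_csym (D : {set T}) : connect_sym (induced e D).
Proof. by apply: sym_connect_sym => x y; rewrite /induced /= simple_sym andbCA. Qed.

Lemma induced_sub (D D' : {set T}) x y :
  D \subset D' -> connect (induced e D) x y -> connect (induced e D') x y.
Proof.
move=> /subsetP s; apply: connect_sub => a b /and3P[/s a1 /s b1 ab].
by apply/connect1/and3P; split.
Qed.

Lemma connected_cut (P : {set T}) x y : x \in P -> y \notin P ->
  exists a b, [/\ a \in P, b \notin P & e a b].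
Proof.
move=> xP yP; move/forallP/(_ x)/forallP/(_ y)/connectP: e_conn => [p].
elim: p x xP => [|z p IH] x xP /=; first by move=> _ yx; rewrite yx xP in yP.
move=> /andP[xz zp] yl; case: (boolP (z \in P)) => zP; first exact: (IH z).
by exists x, z.
Qed.

Lemma dominatingP (D : {set T}) :
  reflect (forall x, exists2 y, y \in D & (x == y) || e x y) (dominating e D).
Proof.
apply: (iffP idP) => [/forallP h x|h].
  case: (boolP (x \in D)) => xD; first by exists x => //; rewrite eqxx.
  move: (h x); rewrite inE xD /= => /existsP[y /andP[yD xy]].
  by exists y => //; rewrite xy orbT.
apply/forallP => x; apply/implyP; rewrite inE => xD.
have [y yD /orP[/eqP xy|xy]] := h x; first by rewrite xy yD in xD.
by apply/existsP; exists y; rewrite yD.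
Qed.

(** [R] contains a representative of each component of [X].  As long as [X] is
    not connected, some component and the rest of [X] are joined by a path
    with at most two inner vertices, because each vertex of the graph is
    adjacent or equal to a vertex of [X].  Adding these two vertices makes one
    representative superfluous. *)
Lemma connected_dominating_extension c : forall X R : {set T}, #|R| <= c -> dominating e X ->
  R \subset X ->
  (forall x, x \in X -> exists2 r, r \in R & connect (induced e X) x r) ->
  exists2 Y : {set T}, connected_dominating e Y & #|Y| <= #|X| + 2 * c.
Proof.
elim: c => [|c IH] X R Rc domX RX XR.
  have R0 : R = set0 by apply/eqP; rewrite -cards_eq0 -leqn0.
  have X0 x : x \in X = false.
    by apply/negP => /XR[r]; rewrite R0 inE.
  exists X; last by rewrite leq_addr.
  by rewrite /connected_dominating domX; apply/forallP=> x; rewrite X0.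
case: (boolP (induced_connected e X)) => [cX|].
  by exists X; [rewrite /connected_dominating domX | rewrite leq_addr].
have [->|] := eqVneq X set0.
  by case/negP; apply/forallP=> x; rewrite inE.
move=> /set0Pn[x0 /XR[r0 r0R _]] ncX.
have r0X : r0 \in X by apply: (subsetP RX).
pose C := [set x in X | connect (induced e X) r0 x].
have [x1 x1X x1C] : exists2 x1, x1 \in X & x1 \notin C.
  apply/exists_inP; apply: contraNT ncX; rewrite negb_exists_in => /forallP h.
  have hC x : x \in X -> connect (induced e X) r0 x.
    by move=> xX; move/implyP/(_ xX): (h x); rewrite negbK inE => /andP[].
  apply/forallP => x; apply/implyP => xX; apply/forallP => y; apply/implyP => yX.
  by apply: (connect_trans (y := r0)); [rewrite induced_csym|]; exact: hC.
pose P := [set z | [exists c in C, (z == c) || e z c]].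
have r0P : r0 \in P.
  by rewrite inE; apply/existsP; exists r0; rewrite inE r0X connect0 eqxx.
(* The path runs from c1 through z and z' to c2.  It is immediate if x1 is
   within distance one of C; otherwise an edge leaving that neighbourhood of C
   supplies z and z'. *)
have [z [z' [c1 [c2 [c1C zc1 c2X zc2 zz]]]]] : exists z z' c1 c2,
    [/\ c1 \in C, (z == c1) || e z c1, c2 \in X :\: C,
        (z' == c2) || e z' c2 & (z == z') || e z z'].
  case: (boolP (x1 \in P)) => x1P.
    move: (x1P); rewrite inE => /existsP[c1 /andP[c1C h]].
    by exists x1, x1, c1, x1; rewrite !eqxx h c1C !inE x1X andbT; rewrite inE x1X in x1C.
  have [a [b [aP bP ab]]] := connected_cut r0P x1P.
  move: aP; rewrite inE => /existsP[c1 /andP[c1C h]].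
  move/dominatingP: (domX) => /(_ b)[c2 c2X bc2].
  exists a, b, c1, c2; split => //; last by rewrite ab orbT.
  rewrite inE c2X andbT; apply: contra bP => c2C.
  by rewrite inE; apply/existsP; exists c2; rewrite c2C.
pose X' := z |: (z' |: X).
have XX' : X \subset X' by apply/subsetP => x xX; rewrite !inE xX !orbT.
have zX' : z \in X' by rewrite !inE eqxx.
have z'X' : z' \in X' by rewrite !inE eqxx orbT.
have step a b : a \in X' -> b \in X' -> (a == b) || e a b -> connect (induced e X') a b.
  move=> aX bX /orP[/eqP->//|ab]; by apply/connect1/and3P; split.
have c1X : c1 \in X by move: c1C; rewrite inE => /andP[].
have c2X0 : c2 \in X by move: c2X; rewrite inE => /andP[].
have r0c1 : connect (induced e X') r0 c1.
  by apply: (induced_sub XX'); move: c1C; rewrite inE => /andP[].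
have c1z : connect (induced e X') z c1 by apply: step => //; apply: (subsetP XX').
have c2z : connect (induced e X') z' c2 by apply: step => //; apply: (subsetP XX').
have zz' : connect (induced e X') z z' by apply: step.
have csym := induced_csym X'.
have r0c2 : connect (induced e X') r0 c2.
  apply: connect_trans r0c1 _; apply: (connect_trans (y := z)); first by rewrite csym.
  exact: connect_trans zz' c2z.
have [r1 r1R c2r1] := XR _ c2X0.
have r10 : r1 != r0.
  apply/eqP => r10; move: c2X; rewrite !inE c2X0 andbT /= => /negP[].
  by rewrite induced_csym -r10.
have r0r1 : connect (induced e X') r0 r1.
  exact: connect_trans r0c2 (induced_sub XX' c2r1).
have X'R x : x \in X -> exists2 r, r \in R :\ r0 & connect (induced e X') x r.
  move=> /XR[r rR xr]; have xr' := induced_sub XX' xr.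
  have [rr0|rr0] := eqVneq r r0.
    by exists r1; [rewrite !inE r10|apply: connect_trans xr' _; rewrite rr0].
  by exists r => //; rewrite !inE rr0.
have [||||Y cY Yc] := IH X' (R :\ r0).
- by move: Rc; rewrite (cardsD1 r0) r0R add1n ltnS.
- apply/dominatingP => x; move/dominatingP: domX => /(_ x)[y yX h].
  by exists y => //; apply: (subsetP XX').
- by apply: subset_trans XX'; apply: subset_trans RX; apply: subD1set.
- move=> x; rewrite !inE => /or3P[/eqP->|/eqP->|/X'R//].
    have [r rR h] := X'R _ c1X; exists r => //; exact: connect_trans c1z h.
  have [r rR h] := X'R _ c2X0; exists r => //; exact: connect_trans c2z h.
exists Y => //; apply: leq_trans Yc _.
rewrite mulnS addnA leq_add2r /X'.
apply: leq_trans (_ : _ <= 1 + (1 + #|X|)) _; last by rewrite addnA addnC.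
by rewrite !cardsU1; rewrite leq_add ?leq_b1 // leq_add ?leq_b1.
Qed.

Lemma domination_number_le D : dominating e D -> domination_number e <= #|D|.
Proof.
move=> dD; rewrite /domination_number; case: arg_minnP => [|D' _]; last exact.
by apply/dominatingP => x; exists x; rewrite ?inE ?eqxx.
Qed.

Lemma domination_number_attained :
  exists2 D, dominating e D & #|D| = domination_number e.
Proof.
rewrite /domination_number; case: arg_minnP => [|D dD _]; last by exists D.
by apply/dominatingP => x; exists x; rewrite ?inE ?eqxx.
Qed.

Lemma connected_dominatingT : connected_dominating e [set: T].
Proof.
apply/andP; split; first by apply/dominatingP => x; exists x; rewrite ?inE ?eqxx.
apply/forallP => x; apply/implyP => _; apply/forallP => y; apply/implyP => _.
rewrite (eq_connect (e' := e)); last by move=> a b; rewrite /induced /= !inE.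
by move/forallP/(_ x)/forallP/(_ y): e_conn.
Qed.

Lemma connected_domination_number_le D :
  connected_dominating e D -> connected_domination_number e <= #|D|.
Proof.
move=> dD; rewrite /connected_domination_number; case: arg_minnP => [|D' _]; last exact.
exact: connected_dominatingT.
Qed.

Lemma connected_domination_number_ge c :
  (forall D, connected_dominating e D -> c <= #|D|) ->
  c <= connected_domination_number e.
Proof.
move=> h; rewrite /connected_domination_number; case: arg_minnP => [|D' /h//].
exact: connected_dominatingT.
Qed.

Section MinDegree.
Variable k : nat.
Hypothesis e_deg : min_degree_ge e k.

Let hit x y := (x == y) || e x y.

Lemma closed_nbhd_card x : k < #|[set y | hit x y]|.
Proof.
have -> : [set y | hit x y] = x |: [set y | e x y].
  by apply/setP => y; rewrite !inE eq_sym.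
rewrite cardsU1 inE simple_irr add1n ltnS.
by move/forallP/(_ x): e_deg.
Qed.

Lemma greedy_dominating (W : {set T}) t : 0 < #|T| ->
  exists2 S : {set T}, #|S| <= t &
    #|[set x in W | [forall y in S, ~~ hit x y]]| * #|T| ^ t
      <= #|W| * (#|T| - k.+1) ^ t.
Proof.
move=> T0; have [|S szS hS] := @greedy_hitting T T hit W k.+1 t T0.
  by move=> x _; exact: closed_nbhd_card.
exists [set y in S]; first by rewrite cardsE -szS card_size.
apply: leq_trans hS; rewrite leq_mul2r; apply/orP; right; apply: subset_leq_card.
apply/subsetP => x; rewrite !inE => /andP[-> /= /forallP h].
by apply/hasPn => y yS; move/implyP: (h y); rewrite inE; apply.
Qed.

(** The vertices left over after [t] greedy steps are added to the set. *)
Lemma domination_number_greedy t : 0 < #|T| ->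
  exists r, domination_number e <= t + r /\ r * #|T| ^ t <= #|T| * (#|T| - k.+1) ^ t.
Proof.
move=> T0; have [S St] := greedy_dominating [set: T] t T0.
set U := [set x in _ | _] => hU; exists #|U|; split; last by rewrite cardsT in hU.
apply: leq_trans (_ : _ <= #|S :|: U|) _; last first.
  by apply: leq_trans (leq_card_setU _ _) _; rewrite leq_add2r.
apply: domination_number_le; apply/dominatingP => x.
case: (boolP (x \in U)) => xU; first by exists x; [rewrite in_setU xU orbT | rewrite eqxx].
move: xU; rewrite !inE /= negb_forall => /existsP[y]; rewrite negb_imply negbK => /andP[yS h].
by exists y => //; rewrite in_setU yS.
Qed.

(** [S] is greedy for a minimum dominating set [D], and [S1] is greedy for
    [S].  Apart from the [r] vertices of [D] not dominated by [S] and the [r1]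
    vertices of [S] not dominated by [S1], each vertex is linked to [S1], so
    that the cost of connecting is governed by [S1] and not by [S]. *)
Lemma connected_domination_number_greedy s s1 : 0 < #|T| ->
  exists r r1,
  [/\ connected_domination_number e <= domination_number e + s + s1 + 2 * (s1 + r1 + r),
      r * #|T| ^ s <= domination_number e * (#|T| - k.+1) ^ s &
      r1 * #|T| ^ s1 <= s * (#|T| - k.+1) ^ s1].
Proof.
move=> T0; have [D domD cD] := domination_number_attained.
have [S Ss] := greedy_dominating D s T0.
have [S1 S1s] := greedy_dominating S s1 T0.
set U1 := [set x in S | _] => hU1; set U := [set x in D | _] => hU.
exists #|U|, #|U1|; rewrite -cD; split => //; last first.
  by apply: leq_trans hU1 _; rewrite leq_mul2r Ss orbT.
have UX : U \subset D by apply/subsetP => x; rewrite inE => /andP[].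
have U1X : U1 \subset S by apply/subsetP => x; rewrite inE => /andP[].
pose X := D :|: S :|: S1; pose R := S1 :|: U1 :|: U.
have cR : #|R| <= s1 + #|U1| + #|U|.
  apply: leq_trans (leq_card_setU _ _) _; rewrite leq_add2r.
  by apply: leq_trans (leq_card_setU _ _) _; rewrite leq_add2r.
have [|||Y cY hY] := @connected_dominating_extension _ X R cR.
- apply/dominatingP => x; move/dominatingP: domD => /(_ x)[y yD h].
  by exists y => //; rewrite !inE yD.
- apply/subsetP => x; rewrite !in_setU => /orP[/orP[->|/(subsetP U1X)->]|/(subsetP UX)->];
    by rewrite ?orbT.
- have step a b : a \in X -> b \in X -> hit a b -> connect (induced e X) a b.
    move=> aX bX /orP[/eqP->//|ab]; by apply/connect1/and3P; split.
  have S1R x : x \in S1 -> exists2 r, r \in R & connect (induced e X) x r.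
    by move=> xS; exists x => //; rewrite !in_setU xS.
  have SR x : x \in S -> exists2 r, r \in R & connect (induced e X) x r.
    move=> xS; case: (boolP (x \in U1)) => xU.
      by exists x => //; rewrite !in_setU xU orbT.
    move: (xU); rewrite inE xS negb_forall => /existsP[y].
    rewrite negb_imply negbK => /andP[yS h].
    have [r rR yr] := S1R _ yS; exists r => //; apply: connect_trans yr.
    by apply: step => //; rewrite !in_setU ?xS ?yS ?orbT.
  move=> x; rewrite !in_setU => /orP[/orP[xD|/SR//]|/S1R//].
  case: (boolP (x \in U)) => xU.
    by exists x => //; rewrite !in_setU xU orbT.
  move: (xU); rewrite inE xD negb_forall => /existsP[y].
  rewrite negb_imply negbK => /andP[yS h].
  have [r rR yr] := SR _ yS; exists r => //; apply: connect_trans yr.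
  by apply: step => //; rewrite !in_setU ?xD ?yS ?orbT.
apply: leq_trans (connected_domination_number_le cY) _.
apply: leq_trans hY _; rewrite leq_add2r.
apply: leq_trans (leq_card_setU _ _) _; apply: leq_add => //.
by apply: leq_trans (leq_card_setU _ _) _; rewrite leq_add2l.
Qed.
End MinDegree.
End Components.

(** * Covering families *)
Section Cover.
Local Open Scope nat_scope.

Lemma card_supersets (T : finType) (S : {set T}) u : #|S| <= u ->
  'C(#|T| - #|S|, u - #|S|) <= #|[set A : {set T} | (#|A| == u) && (S \subset A)]|.
Proof.
move=> Su; have -> : #|T| - #|S| = #|~: S| by rewrite [RHS]cardsCs setCK.
rewrite -cards_draws.
rewrite -(@card_in_imset _ _ (fun B => S :|: B)).
  apply/subset_leq_card/subsetP => A /imsetP[B]; rewrite inE => /andP[BS /eqP cB] ->.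
  rewrite inE subsetUl andbT cardsU cB.
  have -> : S :&: B = set0 by apply/eqP; rewrite setI_eq0 disjoint_sym disjoints_subset.
  by rewrite cards0 subn0 subnKC.
have h B : B \in [set A : {set T} | A \subset ~: S & #|A| == u - #|S|] -> (S :|: B) :\: S = B.
  rewrite inE => /andP[BS _]; rewrite setDUl setDv set0U.
  by apply/setDidPl; rewrite disjoints_subset.
by move=> B C hB hC BC; rewrite -(h B hB) -(h C hC) BC.
Qed.

Lemma extend_card (T : finType) (S : {set T}) s : #|S| <= s -> s <= #|T| ->
  exists2 S' : {set T}, S \subset S' & #|S'| = s.
Proof.
elim: s => [|s IH]; first by rewrite leqn0 cards_eq0 => /eqP-> _; exists set0; rewrite ?cards0.
rewrite leq_eqVlt => /orP[/eqP cS _|Ss sT]; first by exists S.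
have [S' SS' cS'] := IH Ss (ltnW sT).
have : 0 < #|~: S'| by rewrite cardsCs setCK subn_gt0 cS'.
move=> /card_gt0P[x]; rewrite inE => xS; exists (x |: S').
  by apply: subset_trans SS' (subsetUr _ _).
by rewrite cardsU1 xS cS'.
Qed.

(** A uniformly random [u]-set contains a fixed [s]-set with probability
    C(N - s, u - s) / C(N, u).  The hypothesis says that, after [m] greedy
    choices, fewer than one [s]-set remains uncovered. *)
Lemma covering_family N u s m : s <= u -> u <= N ->
  'C(N, s) * ('C(N, u) - 'C(N - s, u - s)) ^ m < 'C(N, u) ^ m ->
  exists F : 'I_m -> {set 'I_N}, (forall i, #|F i| = u) /\
    forall S : {set 'I_N}, #|S| <= s -> exists i, S \subset F i.
Proof.
move=> su uN hC.
pose J := {A : {set 'I_N} | #|A| == u}.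
have cJ : #|{: J}| = 'C(N, u).
  rewrite card_sig -[in RHS](card_ord N) -card_draws.
  by apply: eq_card => A; rewrite !inE.
pose r (S : {set 'I_N}) (A : J) := S \subset val A.
have [||F szF hF] := @greedy_hitting _ _ r [set S : {set 'I_N} | #|S| == s] 'C(N - s, u - s) m.
- by rewrite cJ bin_gt0.
- move=> S; rewrite inE => /eqP cS.
  have su' : #|S| <= u by rewrite cS.
  have := card_supersets su'; rewrite card_ord cS => /leq_trans; apply.
  rewrite -(card_imset _ (val_inj : injective (val : J -> _))).
  apply/subset_leq_card/subsetP => A; rewrite inE => /andP[cA SA].
  by apply/imsetP; exists (Sub A cA : J); rewrite ?inE //= /r SubK.
have m0 : size F == m by rewrite szF.
exists (fun i => val (tnth (Tuple m0) i)); split; first by move=> i; apply/eqP; exact: (svalP (tnth (Tuple m0) i)).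
move=> S Ss; have [|S' SS' cS'] := extend_card Ss; first by rewrite card_ord; exact: leq_trans su uN.
move: hF; rewrite card_draws card_ord cJ => /leq_ltn_trans/(_ hC).
rewrite -[X in _ < X]mul1n ltn_mul2r => /andP[_]; rewrite ltnS leqn0 cards_eq0 => /eqP h0.
have : S' \in set0 = false by rewrite inE.
rewrite -h0 !inE cS' eqxx /= => /negbFE/hasP[A AF S'A].
have /tnthP[i Ai] : A \in Tuple m0 by [].
by exists i; rewrite -Ai; exact: subset_trans SS' S'A.
Qed.
End Cover.

(** * Moving a graph to the vertex set of the definition of M *)
Section Transport.
Local Open Scope nat_scope.

Lemma dominating_image (T T' : finType) (e : rel T) (e' : rel T') (f : T' -> T)
    (g : T -> T') (X : {set T'}) :
  cancel g f -> (forall x y, e' x y = e (f x) (f y)) ->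
  dominating e' X -> dominating e (f @: X).
Proof.
move=> gf ee' /dominatingP domX; apply/dominatingP => x.
have [y yX h] := domX (g x); exists (f y); first exact: imset_f.
case/orP: h => [/eqP <-|]; first by rewrite gf eqxx.
by rewrite ee' gf => ->; rewrite orbT.
Qed.

Lemma connected_dominating_image (T T' : finType) (e : rel T) (e' : rel T')
    (f : T' -> T) (g : T -> T') (X : {set T'}) :
  cancel g f -> (forall x y, e' x y = e (f x) (f y)) ->
  connected_dominating e' X -> connected_dominating e (f @: X).
Proof.
move=> gf ee' /andP[domX /forallP cX]; rewrite /connected_dominating.
rewrite (dominating_image gf ee' domX) /=.
apply/forallP => fx; apply/implyP => /imsetP[x xX ->{fx}].
apply/forallP => fy; apply/implyP => /imsetP[y yX ->{fy}].
move/implyP/(_ xX)/forallP/(_ y)/implyP/(_ yX)/connectP: (cX x) => [p].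
elim: p x xX => [|z p IH] x xX /=; first by move=> _ ->.
move=> /andP[/and3P[_ zX xz] zp] yl; apply: connect_trans (IH z zX zp yl).
by apply/connect1/and3P; split; rewrite ?imset_f // -ee'.
Qed.

Lemma connected_image (T T' : finType) (e : rel T) (e' : rel T')
    (f : T' -> T) (g : T -> T') :
  cancel g f -> (forall x y, e' x y = e (f x) (f y)) ->
  connected_graph e' -> connected_graph e.
Proof.
move=> gf ee' /forallP cX; apply/forallP => x; apply/forallP => y.
rewrite -[x]gf -[y]gf.
move/forallP/(_ (g y))/connectP: (cX (g x)) => [p].
move: (g x) => {}x; elim: p x => [|z p IH] x /=; first by move=> _ ->.
move=> /andP[xz zp] yl; apply: connect_trans (IH z zp yl).
by apply: connect1; rewrite -ee'.
Qed.

Lemma M_ge_graph (T : finType) (e : rel T) k : simple_graph e -> connected_graph e ->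
  min_degree_ge e k ->
  connected_domination_number e - domination_number e <= M #|T| k.
Proof.
move=> se ce de.
pose f : 'I_#|T| -> T := enum_val; pose g : T -> 'I_#|T| := enum_rank.
have gf : cancel g f := enum_rankK.
have fg : cancel f g := enum_valK.
pose E := [set p | e (f p.1) (f p.2)].
have ee x y : edge_rel E x y = e (f x) (f y) by rewrite /edge_rel /= inE.
have ee' x y : e x y = edge_rel E (g x) (g y) by rewrite ee !gf.
have cE := connected_image fg ee' ce.
have condE : [&& simple_graph (edge_rel E), connected_graph (edge_rel E) &
    min_degree_ge (edge_rel E) k].
  apply/and3P; split=> //.
    apply/andP; split; first by apply/forallP => x; rewrite ee (simple_irr se).
    by apply/forallP => x; apply/forallP => y; rewrite !ee (simple_sym se) eqxx.
  apply/forallP => x; move/forallP/(_ (f x)): de => /leq_trans; apply.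
  rewrite /degree -(card_imset _ (can_inj gf)); apply/subset_leq_card/subsetP => y.
  by case/imsetP => z; rewrite inE => xz ->; rewrite inE ee gf.
rewrite /M; apply: (bigop.bigmax_sup E) => //; apply: leq_sub.
  have [X cX <-] : exists2 X, connected_dominating (edge_rel E) X &
      #|X| = connected_domination_number (edge_rel E).
    rewrite /connected_domination_number; case: arg_minnP => [|X cX _]; last by exists X.
    exact: connected_dominatingT.
  rewrite -(card_imset _ (can_inj fg)); apply: connected_domination_number_le => //.
  exact: connected_dominating_image gf ee cX.
have [X dX <-] := domination_number_attained e.
rewrite -(card_imset _ (can_inj gf)); apply: domination_number_le => //.
exact: dominating_image fg ee' dX.
Qed.
End Transport.

(** * The extremal graph *)
Section Gadget.
Local Open Scope nat_scope.
Variables (l N w r m b u s k : nat).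
Variables (F : 'I_m -> {set 'I_N}) (G : 'I_b -> {set 'I_N}).
Hypothesis cF : forall x, #|F x| = u.
Hypothesis cG : forall y, #|G y| = u.
Hypothesis Fcover : forall S : {set 'I_N}, #|S| <= s -> exists x, S \subset F x.
Hypothesis Gcover : forall S : {set 'I_N}, #|S| <= m + s -> exists y, S \subset G y.
Hypotheses (l0 : 0 < l) (uN : u < N) (w0 : 0 < w) (m1 : 1 < m).
Hypothesis deg_outer : k <= (N - u) * w.
Hypothesis deg_core : k < l * N * w + r.

(* A core vertex is (block, type, copy) or one of r spare clique vertices.  An
   outer vertex is (block, centre, o), where o = None is the centre itself and
   o = Some y is its y-th satellite. *)
Let core := ('I_l * 'I_N * 'I_w + 'I_r)%type.
Let outer := ('I_l * 'I_m * option 'I_b)%type.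
Let V := (core + outer)%type.

Definition avoided (x : 'I_m) (o : option 'I_b) : {set 'I_N} :=
  if o is Some y then G y else F x.

Definition touches (a : core) (p : outer) : bool :=
  if a is inl (j, t, _) then (j == p.1.1) && (t \notin avoided p.1.2 p.2) else false.

(** The clique on the core provides the degrees of core vertices, connects the
    graph and makes the core cheap to dominate, without giving any neighbour
    to an outer vertex. *)
Definition gadget : rel V := fun v v' =>
  match v, v' with
  | inl a, inl a' => a != a'
  | inl a, inr p | inr p, inl a => touches a p
  | inr p, inr p' => (p.1 == p'.1) && (isSome p.2 (+) isSome p'.2)
  end.

Lemma card_avoided x o : #|avoided x o| = u.
Proof. by case: o => [y|] /=. Qed.

Lemma gadget_simple : simple_graph gadget.
Proof.
apply/andP; split; first by apply/forallP => -[a|p] /=; rewrite ?eqxx // addbb.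
apply/forallP => -[a|p]; apply/forallP => -[a'|p'] //=; apply/eqP => /=.
  by rewrite eq_sym.
by rewrite eq_sym addbC.
Qed.

Lemma outer_nbhd p : k <= #|[set a | touches a p]|.
Proof.
apply: leq_trans deg_outer _.
case: p => [[j x] o].
have -> : (N - u) * w = #|setX (~: avoided x o) [set: 'I_w]|.
  by rewrite cardsX cardsT card_ord cardsCs setCK card_ord card_avoided.
rewrite -(@card_imset _ core (fun q => inl (j, q.1, q.2))); last first.
  by move=> [t z] [t' z'] [-> ->].
apply/subset_leq_card/subsetP => a /imsetP[[t z]]; rewrite !inE andbT /= => tz ->.
by rewrite /touches /= eqxx tz.
Qed.

Lemma outer_touch p : exists a, touches a p.
Proof.
case: p => [[j x] o].
have : 0 < #|~: avoided x o| by rewrite cardsCs setCK card_ord card_avoided subn_gt0.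
move=> /card_gt0P[t]; rewrite inE => tA.
by exists (inl (j, t, Ordinal w0)); rewrite /touches /= eqxx tA.
Qed.

Lemma gadget_min_degree : min_degree_ge gadget k.
Proof.
apply/forallP => -[a|p].
  apply: leq_trans (_ : #|[set~ a]| <= _).
    rewrite cardsC1 card_sum !card_prod !card_ord.
    by move: deg_core; case: (_ + r).
  rewrite -(card_imset _ (@inl_inj core outer)); apply/subset_leq_card/subsetP => v.
  by case/imsetP => a'; rewrite !inE => h ->; rewrite /= eq_sym.
apply: leq_trans (outer_nbhd p) _.
rewrite -(card_imset _ (@inl_inj core outer)); apply/subset_leq_card/subsetP => v.
by case/imsetP => a'; rewrite !inE => h ->.
Qed.

Lemma gadget_connected : connected_graph gadget.
Proof.
have csym : connect_sym gadget.
  by apply: sym_connect_sym; apply: simple_sym gadget_simple.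
have N0 : 0 < N by apply: leq_ltn_trans uN.
pose a0 : core := inl (Ordinal l0, Ordinal N0, Ordinal w0).
have hub v : connect gadget v (inl a0).
  have ch a : connect gadget (inl a) (inl a0).
    by have [->//|h] := eqVneq a a0; apply: connect1.
  case: v => [a|p] //; have [a ap] := outer_touch p.
  by apply: connect_trans (ch a); apply: connect1.
apply/forallP => v; apply/forallP => v'.
by apply: connect_trans (hub v) _; rewrite csym.
Qed.

Lemma gadget_domination_number : domination_number gadget <= l * m + 1.
Proof.
have N0 : 0 < N by apply: leq_ltn_trans uN.
pose a0 : core := inl (Ordinal l0, Ordinal N0, Ordinal w0).
pose D : {set V} := inl a0 |: [set inr (q, None) | q : 'I_l * 'I_m].
apply: leq_trans (_ : #|D| <= _); last first.
  rewrite cardsU1 addnC leq_add ?leq_b1 //.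
  by rewrite card_imset ?card_prod ?card_ord // => q q' [].
apply: domination_number_le; apply/dominatingP => -[a|[q [y|]]].
- exists (inl a0); first by rewrite !inE eqxx.
  by have [->|h] := eqVneq a a0; rewrite /= ?eqxx // h orbT.
- exists (inr (q, None)); first by apply/setU1P; right; apply: (imset_f (fun q => inr (q, None))).
  by rewrite /= !eqxx ?orbT.
- exists (inr (q, None)); first by apply/setU1P; right; apply: (imset_f (fun q => inr (q, None))).
  by rewrite /= !eqxx ?orbT.
Qed.

Definition block (v : V) : option 'I_l :=
  match v with
  | inl (inl (j, _, _)) => Some j
  | inl (inr _) => None
  | inr (j, _, _) => Some j
  end.

Definition is_center (v : V) : bool := if v is inr (_, None) then true else false.

(** Let [O] be the set of vertices of [X] in a block that are not centres.
    Each is sent to a type: a core vertex to its own type, a satellite to a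
    type in the neighbourhood of what it would have to dominate.  If [O] is
    small, then the covering property yields a centre (when all centres are in
    [X]) or a satellite of a given centre (when that centre is not in [X])
    that misses all these types, hence has no neighbour in [O]. *)
Lemma gadget_connected_dominating (X : {set V}) :
  connected_dominating gadget X -> l * (m + s) <= #|X|.
Proof.
move=> /andP[/dominatingP domX cX].
pose Xb j := [set v in X | block v == Some j].
suff main j : m + s <= #|Xb j|.
  apply: leq_trans (_ : \sum_(j < l) #|Xb j| <= _).
    apply: (@leq_trans (\sum_(j < l) (m + s))); first by rewrite sum_nat_const card_ord.
    by apply: leq_sum => j _; exact: main.
  rewrite -[leqRHS]sum1_card.
  have -> : \sum_(j < l) #|Xb j| = \sum_(j < l) \sum_(v in Xb j) 1.
    by apply: eq_bigr => j0 _; rewrite sum1_card.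
  rewrite (exchange_big_dep (mem X)) /=; last by move=> j0 v _; rewrite inE => /andP[].
  apply: leq_sum => v vX; rewrite sum1_card.
  case bv : (block v) => [j0|].
    rewrite (eq_card (B := pred1 j0)) ?card1 // => j'.
    by transitivity (v \in Xb j') => //; rewrite !inE vX bv /= eq_sym.
  by rewrite eq_card0 // => j'; transitivity (v \in Xb j') => //; rewrite !inE bv andbF.
pose O := [set v in Xb j | ~~ is_center v].
have [h1 h1P] : exists h : 'I_m -> 'I_N, forall x, h x \notin F x.
  apply: (@fin_all_exists _ (fun=> 'I_N) (fun x t => t \notin F x)) => x.
  apply/existsP; rewrite -negb_forall.
  apply/negP => /forallP FT; have : #|F x| = N by rewrite (eq_card (B := 'I_N)) ?card_ord // => t; rewrite FT.
  by move=> h; move: uN; rewrite -(cF x) h ltnn.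
have [h2 h2P] : exists h : 'I_b -> 'I_N, forall x, h x \notin G x.
  apply: (@fin_all_exists _ (fun=> 'I_N) (fun x t => t \notin G x)) => x.
  apply/existsP; rewrite -negb_forall.
  apply/negP => /forallP FT; have : #|G x| = N by rewrite (eq_card (B := 'I_N)) ?card_ord // => t; rewrite FT.
  by move=> h; move: uN; rewrite -(cG x) h ltnn.
have N0 : 0 < N by apply: leq_ltn_trans uN.
have OS (h : V -> 'I_N) : #|h @: O| <= #|O| by apply: leq_imset_card.
have OXb : O \subset Xb j by apply/subsetP => v; rewrite inE => /andP[].
case: (boolP [forall x : 'I_m, (inr (j, x, None) : V) \in X]) => [/forallP DX|].
  pose C : {set V} := [set inr (j, x, None) | x : 'I_m].
  have cC : #|C| = m by rewrite card_imset ?card_ord // => x x' [].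
  have CXb : C \subset Xb j.
    by apply/subsetP => _ /imsetP[x _ ->]; rewrite inE DX /=.
  have CO : [disjoint C & O].
    by rewrite -setI_eq0; apply/eqP/setP => v; rewrite !inE; apply/negP => /andP[/imsetP[x _ ->]]; rewrite andbF.
  apply: leq_trans (_ : #|C :|: O| <= _); last by rewrite subset_leq_card // subUset CXb.
  rewrite cardsU (disjoint_setI0 CO) cards0 subn0 cC leq_add2l.
  rewrite leqNgt; apply/negP => /ltnW Os.
  (* A satellite of x is replaced by a type adjacent to x: if all chosen types
     are missed by x, then no satellite of x is in O. *)
  pose h (v : V) : 'I_N := match v with
    | inl (inl (_, t, _)) => t
    | inr (_, x, _) => h1 x
    | _ => Ordinal N0 end.
  have [x /subsetP xh] := Fcover (leq_trans (OS h) Os).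
  have [x' xx'] : exists x' : 'I_m, x' != x.
    have : 0 < #|[set~ x]| by rewrite cardsC1 card_ord -ltnS prednK // ltnW.
    by move=> /card_gt0P[x']; rewrite !inE => ?; exists x'.
  (* Connectivity enters here: x is joined within X to another centre. *)
  have [v vX xv] : exists2 v, v \in X & gadget (inr (j, x, None)) v.
    move/forallP/(_ (inr (j, x, None)))/implyP/(_ (DX x))/forallP: cX.
    move/(_ (inr (j, x', None)))/implyP/(_ (DX x'))/connectP => [[|v p]] /=.
      by move=> _ [xx]; rewrite xx eqxx in xx'.
    by move=> /andP[/and3P[_ vX xv] _] _; exists v.
  have vO : v \in O.
    rewrite !inE vX; case: v xv {vX} => [[[[j' t] z]|z]|[[j' x1] [y|]]] //=.
    - by move=> /andP[/eqP-> _]; rewrite eqxx.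
    - by rewrite andbT xpair_eqE => /andP[/eqP-> _]; rewrite eqxx.
    - by rewrite andbF.
  have := xh _ (imset_f h vO).
  case: v xv {vX vO} => [[[[j' t] z]|z]|[[j' x1] [y|]]] //=.
  - by move=> /andP[_ /negbTE->].
  - by rewrite andbT xpair_eqE => /andP[_ /eqP<-]; rewrite (negbTE (h1P x)).
  - by rewrite andbF.
rewrite negb_forall => /existsP[x xX].
apply: leq_trans (subset_leq_card OXb).
rewrite leqNgt; apply/negP => /ltnW Os.
pose h (v : V) : 'I_N := match v with
  | inl (inl (_, t, _)) => t
  | inr (_, _, Some y) => h2 y
  | _ => Ordinal N0 end.
have [y /subsetP yh] := Gcover (leq_trans (OS h) Os).
have [v vX yv] := domX (inr (j, x, Some y)).
have vO : v \in O.
  rewrite !inE vX; case: v yv vX => [[[[j' t] z]|z]|[[j' x1] [y1|]]] //=.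
  - by move=> /andP[/eqP-> _]; rewrite eqxx.
  - by rewrite andbF orbF => /eqP[-> _ _]; rewrite eqxx.
  - by rewrite andbT => /orP[/eqP[]//|/eqP[<- <-] xX']; rewrite xX' in xX.
have := yh _ (imset_f h vO).
case: v yv vX vO => [[[[j' t] z]|z]|[[j' x1] [y1|]]] //=.
- by move=> /andP[_ /negbTE->].
- by rewrite andbF orbF => /eqP[_ _ ->]; rewrite (negbTE (h2P _)).
by rewrite !inE /= andbF.
Qed.

Lemma card_gadget : #|{: V}| = l * N * w + r + l * m * b.+1.
Proof. by rewrite !card_sum !card_prod !card_option !card_ord. Qed.

Lemma M_ge_gadget n : n = l * N * w + r + l * m * b.+1 -> l * s <= M n k + 1.
Proof.
move=> ->; rewrite -card_gadget addnC -leq_subLR.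
apply: leq_trans (M_ge_graph gadget_simple gadget_connected gadget_min_degree).
apply: leq_trans (_ : l * (m + s) - (l * m + 1) <= _).
  by rewrite mulnDr subnDl.
apply: leq_sub gadget_domination_number.
apply: connected_domination_number_ge; first exact: gadget_connected.
exact: gadget_connected_dominating.
Qed.
End Gadget.

(** The vertices of the graph that the blocks do not use become spare clique
    vertices, so that every larger [n] is allowed. *)
Lemma M_ge_parameters (l N w m b u s k n : nat) :
  (0 < l -> 0 < w -> 1 < m -> m + s <= u -> u < N -> k <= (N - u) * w ->
  'C(N, s) * ('C(N, u) - 'C(N - s, u - s)) ^ m < 'C(N, u) ^ m ->
  'C(N, m + s) * ('C(N, u) - 'C(N - (m + s), u - (m + s))) ^ b < 'C(N, u) ^ b ->
  l * (N * w + m * b.+1) <= n ->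
  l * s <= M n k + 1)%N.
Proof.
move=> l0 w0 m1 su uN deg hF hG ln.
have [F [cF Fcover]] := covering_family (leq_trans (leq_addl m s) su) (ltnW uN) hF.
have [G [cG Gcover]] := covering_family su (ltnW uN) hG.
apply: (M_ge_gadget (w := w) (r := (n - l * (N * w + m * b.+1))%N) cF cG Fcover Gcover) => //.
  apply: (@leq_trans (l * N * w)%N); last exact: leq_addr.
  apply: leq_ltn_trans deg _.
  rewrite -mulnA; apply: leq_trans (leq_pmull _ l0).
  rewrite ltn_pmul2r // ltn_subrL (leq_ltn_trans _ uN) // andbT.
  apply: leq_trans su; apply: (@leq_trans m); [exact: ltnW | exact: leq_addr].
by rewrite -[LHS](subnKC ln) mulnDr !mulnA [RHS]addnAC.
Qed.

(** * Choice of the parameters of the extremal graph *)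
Lemma bin_le_exp N s : ('C(N, s) <= N ^ s)%N.
Proof.
apply: leq_trans (_ : N ^_ s <= _)%N; first by rewrite -bin_ffact leq_pmulr ?fact_gt0.
elim: s => [|s IH] //; rewrite ffactnSr expnSr; exact: leq_mul IH (leq_subr _ _).
Qed.

(** C(N - s, u - s) / C(N, u) is the product of the [s] factors
    (u - i) / (N - i), each of which is at least g / h. *)
Lemma bin_ratio N u s g h : (u <= N)%N -> (g * N + h * s <= h * u)%N -> (s <= u)%N ->
  (g ^ s * 'C(N, u) <= h ^ s * 'C(N - s, u - s))%N.
Proof.
move=> uN; elim: s => [|s IH] gh su; first by rewrite !expn0 !subn0.
have {}IH := IH (leq_trans (leq_add (leqnn _) (leq_mul (leqnn h) (leqnSn s))) gh) (ltnW su).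
have Ns : (0 < N - s)%N by rewrite subn_gt0; exact: leq_trans uN.
rewrite -(leq_pmul2r Ns).
have E : ('C(N - s.+1, u - s.+1) * (N - s) = (u - s) * 'C(N - s, u - s))%N.
  rewrite !subnS mulnC mul_bin_diag.
  by rewrite prednK // subn_gt0.
rewrite -[leqRHS]mulnA E.
apply: leq_trans (_ : h ^ s * 'C(N - s, u - s) * (h * (u - s)) <= _)%N; last first.
  by rewrite expnSr; apply/eq_leq; ring.
apply: leq_trans (leq_mul IH (leqnn _)).
rewrite expnSr -!mulnA leq_mul2l; apply/orP; right.
rewrite mulnCA leq_mul2l; apply/orP; right.
rewrite !mulnBr; apply: leq_trans (_ : g * N <= _)%N; first exact: leq_subr.
rewrite -(leq_add2r (h * s)) subnK; last by rewrite leq_mul2l ltnW ?orbT.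
by apply: leq_trans gh; rewrite leq_add2l leq_mul2l leqnSn orbT.
Qed.

(** With rho the probability that a random [u]-set contains a given [s]-set,
    the condition reads C(N, s) * (1 - rho) ^ m < 1; it follows from
    C(N, s) <= N ^ s, 1 - rho <= exp (- rho) and rho >= (g / h) ^ s. *)
Lemma covering_condition (R : realType) (N u s m g h : nat) :
  (0 < N)%N -> (0 < h)%N -> (u <= N)%N -> (g * N + h * s <= h * u)%N -> (s <= u)%N ->
  s%:R * ln N%:R < m%:R * (g%:R / h%:R) ^+ s :> R ->
  ('C(N, s) * ('C(N, u) - 'C(N - s, u - s)) ^ m < 'C(N, u) ^ m)%N.
Proof.
move=> N0 h0 uN gh su hm.
set C1 := 'C(N, u); set C2 := 'C(N - s, u - s).
have C10 : 0 < C1%:R :> R by rewrite ltr0n bin_gt0.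
pose rho : R := C2%:R / C1%:R.
have hR : 0 < h%:R :> R by rewrite ltr0n.
have NR : 0 < N%:R :> R by rewrite ltr0n.
have rho_ge : (g%:R / h%:R) ^+ s <= rho.
  rewrite /rho expr_div_n ler_pdivrMr ?exprn_gt0 // mulrAC ler_pdivlMr //.
  by rewrite -!natrX -!natrM ler_nat [leqRHS]mulnC bin_ratio.
have E1 : (C1 - C2)%:R <= C1%:R * expR (- rho).
  have [C21|C12] := leqP C2 C1; last first.
    by rewrite (eqP (ltnW C12 : (C1 - C2 == 0)%N)) mulr_ge0 ?expR_ge0.
  rewrite natrB //; apply: le_trans (_ : C1%:R * (1 + - rho) <= _).
    by rewrite mulrDr mulr1 mulrN /rho mulrCA divff ?gt_eqF // mulr1.
  by rewrite ler_pM2l // expR_ge1Dx.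
rewrite -(ltr_nat R) natrM !natrX.
apply: le_lt_trans (_ : expR (s%:R * ln N%:R) * (C1%:R * expR (- rho)) ^+ m < _).
  apply: ler_pM; rewrite ?ler0n ?exprn_ge0 //.
    by rewrite expRM_natl lnK ?posrE // -natrX ler_nat bin_le_exp.
  by apply: lerXn2r; rewrite ?nnegrE ?mulr_ge0 ?expR_ge0.
rewrite exprMn mulrCA gtr_pMr ?exprn_gt0 //.
rewrite -expRM_natl -expRD expR_lt1.
have : m%:R * (g%:R / h%:R) ^+ s <= m%:R * rho by rewrite ler_wpM2l.
by rewrite mulrN subr_lt0; apply: lt_le_trans.
Qed.

Section Asymptotics.
Variable R : realType.
Implicit Types (x y z lam eps C : R).

Lemma expR_ge_square_eventually (c b : R) : 0 < b ->
  exists Y : R, forall x, Y <= x -> c * x ^+ 2 <= expR (b * x).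
Proof.
move=> b0; have b3 : 0 < b ^+ 3 by exact: exprn_gt0.
exists (Num.max 0 (6%:R * c / b ^+ 3)) => x; rewrite ge_max ler_pdivrMr // => /andP[x0 cx].
have bx0 : 0 <= b * x by rewrite mulr_ge0 // ltW.
apply: le_trans (expR_ge1Dxn 2 bx0).
rewrite (_ : 3`! = 6)%N //; have : 6%:R * c * x ^+ 2 <= x * b ^+ 3 * x ^+ 2.
  by rewrite ler_wpM2r // exprn_ge0.
have -> : x * b ^+ 3 * x ^+ 2 = (b * x) ^+ 3 by ring.
lra.
Qed.

(** Here y = ln (ln d).  The choice is s = y (1 - eps) / lam and
    m = exp ((1 - eps / 2) y), rounded down; the gap between the exponents
    1 - eps and 1 - eps / 2 pays for the logarithmic factors in the covering
    condition. *)
Lemma block_sizes lam eps : 0 < lam -> 0 < eps -> eps <= 1 ->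
  exists Y : R, forall y, Y <= y -> exists m s : nat,
    [/\ (1 < m)%N, (1 - eps) * y / lam < s%:R + 1, lam * s%:R <= (1 - eps) * y &
    [/\ expR ((1 - eps / 2) * y) / 2 <= m%:R, m%:R <= expR y,
        s%:R <= expR y & lam * (m + s)%:R <= expR y / 4%:R]].
Proof.
move=> lam0 e0 e1.
pose Y1 := Num.max 16%:R (Num.max (2 / lam) (16%:R * lam / eps)).
exists Y1 => y; rewrite !ge_max => /and3P[y16 ylam yeps].
have y0 : 0 < y by move: y16; clear; lra.
have yL : 1 + y <= expR y by exact: expR_ge1Dx.
have yL2 : y ^+ 2 / 2 <= expR y.
  by apply: le_trans (expR_ge1Dxn 1 (ltW y0)); rewrite lerDr.
pose z := expR ((1 - eps / 2) * y); pose E := expR (eps / 2 * y).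
have zE : z * E = expR y by rewrite /z /E -expRD; congr expR; ring.
have z_ge : 1 + (1 - eps / 2) * y <= z by exact: expR_ge1Dx.
have E_ge : 1 + eps / 2 * y <= E by exact: expR_ge1Dx.
have ey0 : 0 < eps * y by exact: mulr_gt0.
have ey : eps * y <= y by rewrite ger_pMl.
have E8 : 8%:R * lam <= E.
  by move: yeps E_ge; rewrite ler_pdivrMr //; clear; lra.
have ez : 4%:R <= z by move: z_ge ey y16; clear; lra.
have zy : z <= expR y.
  by rewrite -zE ler_peMr ?expR_ge0 //; move: E_ge ey0; clear; lra.
have s_arg : 0 <= (1 - eps) * y / lam.
  by rewrite divr_ge0 ?mulr_ge0 ?subr_ge0 // ltW.
pose s := Num.truncn ((1 - eps) * y / lam); pose m := Num.truncn z.
have sle : s%:R <= (1 - eps) * y / lam by rewrite truncn_le.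
have slam : lam * s%:R <= (1 - eps) * y by move: sle; rewrite ler_pdivlMr // mulrC.
have mle : m%:R <= z by rewrite truncn_le expR_ge0.
have mlt : z < m%:R + 1 by rewrite natr1 truncnS_gt.
have s_le : s%:R <= y ^+ 2 / 2.
  apply: le_trans sle _; rewrite (_ : y ^+ 2 / 2 = y / 2 * y); last by ring.
  rewrite mulrAC ler_pM2r //; apply: le_trans (_ : lam^-1 <= _).
    by rewrite ger_pMl ?invr_gt0 // gerBl ltW.
  by rewrite [y / 2]mulrC ler_pdivlMl.
exists m, s; split => //; last split.
- by rewrite -(ltr_nat R); move: mlt ez; clear; lra.
- by rewrite natr1 truncnS_gt.
- by rewrite -/z; move: mlt ez; clear; lra.
- exact: le_trans zy.
- exact: le_trans yL2.
rewrite natrD mulrDr.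
have lm : 8%:R * lam * m%:R <= expR y.
  by rewrite -zE mulrC; apply: ler_pM => //; rewrite mulr_ge0 // ltW.
have yy : 16%:R * y <= y ^+ 2 by rewrite expr2 ler_pM2r.
by move: lm yy yL2 slam ey0; clear; lra.
Qed.

(** The two strict inequalities are the covering conditions for the centres and
    for the satellites, with exp (- lam) in the role of q, and the last one
    says that a block spends only o(d) vertices beyond those needed for the
    degrees.  With [m + s] at most 2 exp y = 2 ln d and lam * (m + s) at most
    a quarter of ln d, the square root of d is a possible size for [b]. *)
Lemma asymptotic_parameters lam eps C : 0 < lam -> 0 < eps -> eps <= 1 -> 0 < C ->
  exists Y : R, forall y, Y <= y -> exists m s b : nat,
    [/\ (1 < m)%N, (1 - eps) * y / lam < s%:R + 1 &
    forall N : nat, (0 < N)%N -> N%:R = C * (m + s)%:R ->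
      [/\ s%:R * ln N%:R < m%:R * expR (- (lam * s%:R)),
          (m + s)%:R * ln N%:R < b%:R * expR (- (lam * (m + s)%:R)) &
          2 * N%:R + m%:R * (b%:R + 1) <= eps / 2 * expR (expR y)]].
Proof.
move=> lam0 e0 e1 C0.
have [Y1 H1] := block_sizes lam0 e0 e1.
have eh0 : 0 < eps / 2 by exact: divr_gt0.
have [Y2 H2] := expR_ge_square_eventually (8%:R / lam) eh0.
have [Y3 H3] := @expR_ge_square_eventually 16%:R (1 / 4%:R) (divr_gt0 ltr01 (ltr0n _ 4)).
have [Y4 H4] := @expR_ge_square_eventually ((8%:R * C + 4%:R) / eps) (1 / 2) (divr_gt0 ltr01 (ltr0n _ 2)).
exists (Num.max 4%:R (Num.max (2 * C) (Num.max Y1 (Num.max Y2 (Num.max Y3 Y4))))).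
move=> y; rewrite !ge_max => /and5P[y4 yC yY1 yY2 /andP[yY3 yY4]].
have [m [s [m1 slt slam [mge mle sle lamT]]]] := H1 _ yY1.
have {}H2 := H2 _ yY2.
have yL : 1 + y <= expR y by exact: expR_ge1Dx.
have yL' : y <= expR y by move: yL; clear; lra.
have {}H3 := H3 _ (le_trans yY3 yL').
have {}H4 := H4 _ (le_trans yY4 yL').
set L := expR y in yL yL' H3 H4 mle sle lamT *.
have L5 : 5%:R <= L by move: yL y4; clear; lra.
have L0 : 0 < L by move: L5; clear; lra.
have y0 : 0 < y by move: y4; clear; lra.
pose B := expR (1 / 2 * L).
have B0 : 0 < B by exact: expR_gt0.
have BB : B * B = expR L by rewrite -expRD; congr expR; clear; lra.
have B2 : 1 + 1 / 2 * L <= B by exact: expR_ge1Dx.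
pose b := Num.truncn B.
have ble : b%:R <= B by rewrite truncn_le ltW.
have blt : B < b%:R + 1 by rewrite natr1 truncnS_gt.
have TR : (m + s)%:R <= 2 * L by rewrite natrD; move: mle sle; clear; lra.
exists m, s, b; split => // N N0 NE.
have NL : N%:R <= 2 * C * L.
  by rewrite NE (_ : 2 * C * L = C * (2 * L)); [rewrite ler_pM2l | ring].
have lnN : ln N%:R <= 2 * y.
  rewrite -ler_expR lnK ?posrE ?ltr0n // mulr2n mulrDl mul1r expRD -/L.
  by apply: le_trans NL _; rewrite ler_pM2r //; exact: le_trans yL'.
have lnN0 : 0 <= ln (N%:R : R) by rewrite ln_ge0 // ler1n.
split.
- apply: le_lt_trans (_ : y / lam * (2 * y) < _).
    apply: ler_pM => //; rewrite ler_pdivlMr // mulrC.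
    by apply: le_trans slam _; rewrite ger_pMl // gerBl ltW.
  apply: lt_le_trans (_ : expR (eps / 2 * y) / 2 <= _); last first.
    apply: le_trans (_ : expR ((1 - eps / 2) * y) / 2 * expR (- (lam * s%:R)) <= _).
      rewrite [leRHS]mulrAC ler_pM2r ?invr_gt0 ?ltr0n // -expRD ler_expR.
      by move: slam; clear; lra.
    by rewrite ler_pM2r ?expR_gt0.
  have -> : y / lam * (2 * y) = 8%:R / lam * y ^+ 2 / 4%:R by field; rewrite gt_eqF.
  by move: H2 (expR_gt0 (eps / 2 * y)); clear; lra.
- apply: le_lt_trans (_ : (2 * L) * (2 * L) < _).
    by apply: ler_pM => //; move: lnN yL'; clear; lra.
  apply: lt_le_trans (_ : expR (1 / 4%:R * L) / 2 <= _); last first.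
    apply: le_trans (_ : B / 2 * expR (- (lam * (m + s)%:R)) <= _).
      rewrite [leRHS]mulrAC ler_pM2r ?invr_gt0 ?ltr0n // /B -expRD ler_expR.
      by move: lamT; clear; lra.
    by rewrite ler_pM2r ?expR_gt0 //; move: blt B2 L5; clear; lra.
  move: H3 (expR_gt0 (1 / 4%:R * L)); rewrite expr2; clear; lra.
have mb : m%:R * (b%:R + 1) <= L * (2 * B).
  by apply: ler_pM => //; [rewrite addr_ge0|move: ble B2 L0; clear; lra].
have BY : (8%:R * C + 4%:R) * L * B <= eps * expR L.
  rewrite -BB [leRHS]mulrA ler_pM2r // [leRHS]mulrC -ler_pdivrMr //.
  apply: le_trans H4; rewrite mulrAC ler_wpM2l //.
    by rewrite divr_ge0 ?addr_ge0 ?mulr_ge0 ?ltW.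
  by rewrite expr2 ler_peMr ?ltW //; move: L5; clear; lra.
have CLB : C * L <= C * L * B.
  by rewrite ler_peMr ?mulr_ge0 ?(ltW C0) ?(ltW L0) //; move: B2 L0; clear; lra.
rewrite -/L; move: BY CLB mb NL; rewrite mulrDl mulrDl; clear; lra.
Qed.

(** Of N = h P (m + s) types, each outer vertex misses
    u = (g P + 1) (m + s).  The summand m + s makes each of the factors
    (u - i) / (N - i) with i < m + s at least g / h, and it is absorbed by
    taking [P] of order 1 / eps. *)
Lemma M_ge_block (g h P l m s b k n : nat) (eps : R) :
  (0 < g)%N -> (g < h)%N -> 0 < eps -> eps <= 1 -> 1 + 2 / eps <= P%:R -> (1 < P)%N ->
  (0 < l)%N -> (1 < m)%N ->
  let N := (h * P * (m + s))%N in let q : R := g%:R / h%:R in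
  s%:R * ln N%:R < m%:R * q ^+ s ->
  (m + s)%:R * ln N%:R < b%:R * q ^+ (m + s) ->
  2 * N%:R + m%:R * (b%:R + 1) <= eps / 2 * (k + 1)%:R ->
  (1 + eps) * l%:R * (k + 1)%:R * h%:R <= n%:R * (h%:R - g%:R) ->
  (l * s <= M n k + 1)%N.
Proof.
move=> g0 gh e0 e1 PR P1 l0 m1 N q c1 c2 small ln_.
have h0 : (0 < h)%N by exact: leq_trans gh.
have hR : 0 < h%:R :> R by rewrite ltr0n.
have gR : 0 <= g%:R :> R by [].
have ghR : 1 <= h%:R - g%:R :> R by rewrite lerBrDl natr1 ler_nat.
pose T := (m + s)%N; pose u := ((g * P + 1) * T)%N.
have T0 : (0 < T)%N by rewrite addn_gt0 ltnW.
have gPh : (g * P + 1 < h * P)%N.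
  apply: (@leq_trans (g.+1 * P)); last by rewrite leq_mul2r gh orbT.
  by rewrite mulSn [leqRHS]addnC addn1 -addn2 leq_add2l.
have uN : (u < N)%N by rewrite ltn_pmul2r.
have N0 : (0 < N)%N by apply: leq_ltn_trans uN.
have Tu : (T <= u)%N by rewrite leq_pmull // addn1.
have cond t : (t <= T)%N -> (g * N + h * t <= h * u)%N.
  move=> tT; apply: (@leq_trans (g * N + h * T)%N).
    by rewrite leq_add2l leq_mul2l tT orbT.
  by apply/eq_leq; rewrite /N /u -/T; ring.
have sT : (s <= T)%N by exact: leq_addl.
pose a := (N - u)%N; pose w := (k %/ a).+1.
have a0 : (0 < a)%N by rewrite subn_gt0.
have deg : (k <= a * w)%N by rewrite mulnC ltnW // ltn_ceil.
have aw : (a * w <= k + a)%N by rewrite /w mulnS addnC leq_add2r mulnC leq_trunc_div.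
pose D : R := (h%:R - g%:R) * P%:R.
have aE : a%:R = (D - 1) * T%:R :> R.
  by rewrite /a natrB 1?ltnW // /N /u -/T !(natrM, natrD) /D; ring.
have P1R : D <= (1 + eps / 2) * (D - 1).
  have : (1 + 2 / eps) * eps <= D * eps.
    by rewrite ler_pM2r //; apply: le_trans PR _; rewrite ler_peMl.
  by rewrite mulrDl mulfVK ?gt_eqF //; clear; lra.
have Nw : (h%:R - g%:R) * (N * w)%:R <= h%:R * ((1 + eps / 2) * (k + 1)%:R + (1 + eps / 2) * N%:R) :> R.
  have -> : (h%:R - g%:R) * (N * w)%:R = D * (h%:R * T%:R * w%:R) :> R.
    by rewrite /N !natrM /D -/T; ring.
  apply: le_trans (_ : (1 + eps / 2) * (D - 1) * (h%:R * T%:R * w%:R) <= _).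
    by rewrite ler_wpM2r // !mulr_ge0.
  have -> : (1 + eps / 2) * (D - 1) * (h%:R * T%:R * w%:R)
     = h%:R * ((1 + eps / 2) * (a * w)%:R) :> R.
    by rewrite natrM aE; ring.
  rewrite ler_pM2l // -mulrDr ler_pM2l; last by move: e0; clear; lra.
  rewrite -natrD ler_nat; apply: leq_trans aw _.
  by rewrite addn1 leq_add // leq_subr.
have size : (l * (N * w + m * b.+1) <= n)%N.
  rewrite -(ler_nat R) -(ler_pM2r (lt_le_trans ltr01 ghR)).
  apply: le_trans ln_.
  have -> : (1 + eps) * l%:R * (k + 1)%:R * h%:R = l%:R * (h%:R * ((1 + eps) * (k + 1)%:R)) by ring.
  rewrite natrM -mulrA ler_pM2l ?ltr0n // mulrC natrD mulrDr.
  have mb : (h%:R - g%:R) * (m * b.+1)%:R <= h%:R * (m%:R * (b%:R + 1)) :> R.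
    by rewrite natrM -natr1 ler_wpM2r ?mulr_ge0 ?addr_ge0 // gerBl.
  apply: le_trans (lerD Nw mb) _; rewrite -mulrDr ler_pM2l //.
  have NN : eps * N%:R <= N%:R by rewrite ger_pMl ?ltr0n.
  by move: small NN (ltr0n R N); rewrite N0 -/N; clear; lra.
apply: (@M_ge_parameters l N w m b u s k n) => //.
- by apply: (@covering_condition R _ _ _ _ g h) => //; [exact: ltnW | exact: cond | exact: leq_trans Tu].
- by apply: (@covering_condition R _ _ _ _ g h) => //; [exact: ltnW | exact: cond].
Qed.

Lemma M_lower (g h : nat) (eps : R) : (0 < g)%N -> (g < h)%N ->
  0 < eps -> eps <= 1 ->
  exists Y : R, forall k l n : nat, Y <= ln (ln (k + 1)%:R) -> (0 < l)%N ->
    (1 + eps) * l%:R * (k + 1)%:R * h%:R <= n%:R * (h%:R - g%:R) ->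
    l%:R * ((1 - eps) * ln (ln (k + 1)%:R) / ln (h%:R / g%:R) - 2%:R) <= (M n k)%:R.
Proof.
move=> g0 gh e0 e1.
have gR : 0 < g%:R :> R by rewrite ltr0n.
have hR : 0 < h%:R :> R by rewrite ltr0n (leq_trans g0) // ltnW.
set lam := ln (h%:R / g%:R).
have lam0 : 0 < lam by rewrite ln_gt0 // ltr_pdivlMr // mul1r ltr_nat.
have pw t : (g%:R / h%:R) ^+ t = expR (- (lam * t%:R)) :> R.
  by rewrite -mulNr expRM_natr expRN lnK ?posrE ?divr_gt0 // invf_div.
pose P := (Num.truncn (2 / eps)).+2.
have PR : 1 + 2 / eps <= P%:R.
  by rewrite /P -[_.+2%:R]natr1; have := truncnS_gt (2 / eps); lra.
have hP0 : (0 < h * P)%N by rewrite muln_gt0 (leq_trans g0) // ltnW.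
have C0 : 0 < (h * P)%:R :> R by rewrite ltr0n.
have [Y HY] := asymptotic_parameters lam0 e0 e1 C0.
exists (Num.max 1 Y) => k l n; rewrite ge_max => /andP[y1 yY] l0 ln_.
have [m [s [b [m1 slt H]]]] := HY _ yY.
have L1 : 1 < ln (k + 1)%:R :> R.
  by rewrite ltNge; apply/negP => /ln_le0; move: y1; clear; lra.
have L0 : 0 < ln (k + 1)%:R :> R := lt_trans ltr01 L1.
have d0 : 0 < (k + 1)%:R :> R by rewrite ltr0n addn1.
have N0 : (0 < h * P * (m + s))%N by rewrite muln_gt0 hP0 addn_gt0 ltnW.
have [c1 c2] := H _ N0 (natrM _ _ _); rewrite lnK // lnK // => c3.
have {c1 c2 c3} : (l * s <= M n k + 1)%N.
  by apply: (@M_ge_block g h P l m s b k n eps) => //; rewrite pw.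
rewrite -(ler_nat R) natrM natrD => ls.
have : l%:R * ((1 - eps) * ln (ln (k + 1)%:R) / lam - 2%:R) <= l%:R * (s%:R - 1).
  by rewrite ler_pM2l ?ltr0n //; move: slt; clear; lra.
have : 1 <= l%:R :> R by rewrite ler1n.
by rewrite [_ * (s%:R - 1)]mulrBr mulr1; move: ls; clear; lra.
Qed.

End Asymptotics.

(** * The function psi and the upper bound *)
Section Psi.
Variable R : realType.
Implicit Types (nu y eta eps : R).

(** This is nu * Phi nu: the number of greedy vertices that reduces the
    undominated part by a factor e. *)
Definition psi nu : R := (ln (nu / (nu - 1)))^-1.

Lemma ln_ratio_ge nu : 1 < nu -> nu^-1 <= ln (nu / (nu - 1)).
Proof.
move=> nu1; have -> : nu / (nu - 1) = (1 + - nu^-1)^-1.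
  by field; rewrite !gt_eqF //; lra.
have v1 : nu^-1 < 1 by rewrite invf_lt1 //; lra.
rewrite lnV ?posrE ?subr_gt0 // lerNr; apply: le_ln1Dx.
by rewrite ltrN2.
Qed.

Lemma ln_ratio_le nu : 1 < nu -> ln (nu / (nu - 1)) <= (nu - 1)^-1.
Proof.
move=> nu1; have -> : nu / (nu - 1) = 1 + (nu - 1)^-1.
  by field; rewrite gt_eqF //; lra.
apply: le_ln1Dx; apply: (@lt_trans _ _ 0); first lra.
by rewrite invr_gt0; lra.
Qed.

Lemma ln_ratio_gt0 nu : 1 < nu -> 0 < ln (nu / (nu - 1)).
Proof. by move=> nu1; apply: lt_le_trans (ln_ratio_ge nu1); rewrite invr_gt0; lra. Qed.

Lemma psi_gt0 nu : 1 < nu -> 0 < psi nu.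
Proof. by move=> nu1; rewrite invr_gt0 ln_ratio_gt0. Qed.

Lemma psi_le nu : 1 < nu -> psi nu <= nu.
Proof.
move=> nu1; rewrite -[leRHS]invrK lef_pV2 ?posrE ?ln_ratio_gt0 ?invr_gt0 ?ln_ratio_ge //; lra.
Qed.

Lemma psi_ge nu : 1 < nu -> nu - 1 <= psi nu.
Proof.
move=> nu1; rewrite -[leLHS]invrK lef_pV2 ?posrE ?ln_ratio_gt0 ?invr_gt0 ?ln_ratio_le //; lra.
Qed.

Lemma greedy_remainder_le (n d r c t : nat) : (0 < d)%N -> (d < n)%N ->
  (r * n ^ t <= c * (n - d) ^ t)%N ->
  r%:R <= c%:R * expR (- (t%:R / psi (n%:R / d%:R))) :> R.
Proof.
move=> d0 dn h.
have nR : 0 < n%:R :> R by rewrite ltr0n (leq_trans d0) // ltnW.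
have dR : 0 < d%:R :> R by rewrite ltr0n.
have ndR : 0 < n%:R - d%:R :> R by rewrite subr_gt0 ltr_nat.
have -> : expR (- (t%:R / psi (n%:R / d%:R))) = ((n%:R - d%:R) / n%:R) ^+ t.
  rewrite /psi invrK -mulrN expRM_natl; congr (_ ^+ _).
  rewrite expRN lnK ?posrE.
    by field; rewrite !gt_eqF //; lra.
  have -> : n%:R / d%:R / (n%:R / d%:R - 1) = n%:R / (n%:R - d%:R) :> R.
    by field; rewrite !gt_eqF //; lra.
  exact: divr_gt0.
rewrite expr_div_n mulrA ler_pdivlMr ?exprn_gt0 //.
by rewrite -natrB 1?ltnW // -!natrX -!natrM ler_nat.
Qed.

(** The sizes are s = psi nu * y, s1 = eps * nu * y and t = nu * L, rounded up.
    Then the domination number is at most t + nu, at most 3 nu vertices of a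
    minimum dominating set are missed by [S], and the part of [S] missed by [S1] is at most
    nu (1 + 1 / eps), since exp (eps y) >= 1 + eps y. *)
Lemma M_upper eps (k n : nat) : 0 < eps -> (k + 1 < n)%N ->
  let nu : R := n%:R / (k + 1)%:R in let y : R := ln (ln (k + 1)%:R) in
  0 < y -> (M n k)%:R <= psi nu * y + nu * (3%:R * eps * y + 12%:R + 2 / eps).
Proof.
move=> e0 kn nu y; set d : R := (k + 1)%:R in nu y *; set L := ln d in y *.
move=> y0.
have d0 : 0 < d by rewrite ltr0n addn1.
have nu1 : 1 < nu by rewrite ltr_pdivlMr // mul1r ltr_nat.
have L1 : 1 < L by rewrite ltNge; apply/negP => /ln_le0; rewrite -/y; lra.
have L0 : 0 < L := lt_trans ltr01 L1.
have EL : expR y = L by rewrite lnK.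
have Ed : expR L = d by rewrite lnK // posrE.
have nu0 : 0 < nu := lt_trans ltr01 nu1.
have psi0 := psi_gt0 nu1; have psin := psi_le nu1.
have ie : 0 < eps^-1 by rewrite invr_gt0.
have bnd : 0 <= psi nu * y + nu * (3%:R * eps * y + 12%:R + 2 / eps).
  apply: addr_ge0; first by rewrite ltW // mulr_gt0.
  apply: mulr_ge0; rewrite -?(mulrA 3%:R); first exact: ltW.
  by move: (mulr_gt0 e0 y0) ie; clear; lra.
rewrite -truncn_ge_nat //; apply/bigop.bigmax_leqP => G /and3P[sG cG dG].
rewrite truncn_ge_nat //.
set e := edge_rel G in sG cG dG *.
pose s := (Num.truncn (psi nu * y)).+1.
pose s1 := (Num.truncn (eps * nu * y)).+1.
pose t := (Num.truncn (nu * L)).+1.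
have n0 : (0 < #|'I_n|)%N by rewrite card_ord; apply: leq_ltn_trans kn.
have [r0 [hr0]] := domination_number_greedy sG dG t n0.
have [r [r1 [hc]]] := connected_domination_number_greedy sG cG dG s s1 n0.
rewrite !card_ord -addn1 => hr hr1 hr0'.
have surv := @greedy_remainder_le n (k + 1) _ _ _ _ kn; rewrite -/nu in surv.
have {}surv a b c : (a * n ^ c <= b * (n - (k + 1)) ^ c)%N ->
   a%:R <= b%:R * expR (- (c%:R / psi nu)) by apply: surv; rewrite addn1.
have sge : psi nu * y < s%:R by exact: truncnS_gt.
have s1ge : eps * nu * y < s1%:R by exact: truncnS_gt.
have tge : nu * L < t%:R by exact: truncnS_gt.
have sle : s%:R <= psi nu * y + 1.
  by rewrite -natr1 lerD2r truncn_le ltW // mulr_gt0 //.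
have s1le : s1%:R <= eps * nu * y + 1.
  by rewrite -natr1 lerD2r truncn_le ltW // mulr_gt0 // mulr_gt0 //.
have tle : t%:R <= nu * L + 1.
  by rewrite -natr1 lerD2r truncn_le ltW // mulr_gt0 //.
have nuL : nu <= nu * L by rewrite ler_peMr //; lra.
have r0R : r0%:R <= nu.
  apply: le_trans (surv _ _ _ hr0') _.
  have nuE : nu = n%:R * expR (- L) by rewrite expRN Ed.
  rewrite [leRHS]nuE ler_wpM2l // ler_expR lerN2 ler_pdivlMr //.
  by apply: le_trans (ltW tge); rewrite [L * _]mulrC ler_pM2r.
have gam : (domination_number e)%:R <= nu * L + 1 + nu.
  apply: (@le_trans _ _ (t%:R + r0%:R)); last by rewrite lerD.
  by rewrite -natrD ler_nat.
have rR : r%:R <= 3%:R * nu.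
  apply: le_trans (surv _ _ _ hr) _.
  apply: le_trans (_ : (nu * L + 1 + nu) * L^-1 <= _); last first.
    by rewrite ler_pdivrMr; lra.
  apply: ler_pM; rewrite ?expR_ge0 //.
  by rewrite -EL -expRN ler_expR lerN2 ler_pdivlMr // mulrC ltW.
have r1R : r1%:R <= nu * (1 + eps^-1).
  apply: le_trans (surv _ _ _ hr1) _.
  have ey : 0 < eps * y by exact: mulr_gt0.
  apply: le_trans (_ : (nu * (y + 1)) * (1 + eps * y)^-1 <= _).
    apply: ler_pM; rewrite ?expR_ge0 //.
      apply: le_trans sle _; rewrite mulrDr mulr1 lerD //; last lra.
      by rewrite ler_pM2r.
    rewrite expRN lef_pV2 ?posrE ?expR_gt0 //; last lra.
    apply: le_trans (expR_ge1Dx _) _; rewrite ler_expR ler_pdivlMr //.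
    by apply: le_trans (ltW s1ge); rewrite [leLHS]mulrAC ler_pM2r // ler_pM2l.
  rewrite -mulrA ler_pM2l; last lra.
  rewrite ler_pdivrMr; last lra.
  have -> : (1 + eps^-1) * (1 + eps * y) = 1 + eps * y + eps^-1 + y.
    by field; rewrite gt_eqF.
  lra.
have hM : (connected_domination_number e - domination_number e)%:R
    <= s%:R + s1%:R + 2 * (s1%:R + r1%:R + r%:R) :> R.
  rewrite -!natrD -natrM -natrD ler_nat leq_subLR.
  by rewrite !addnA.
apply: le_trans hM _.
have -> : psi nu * y + nu * (3%:R * eps * y + 12%:R + 2 * eps^-1)
  = psi nu * y + 3%:R * (eps * nu * y) + 12%:R * nu + 2 * (nu * eps^-1) by ring.
move: r1R; rewrite mulrDr mulr1; lra.
Qed.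

(** * Finitely many block densities suffice *)
Lemma neg_ln_le (x : R) : 0 <= x -> x <= 1 / 2 -> - ln (1 - x) <= 2 * x.
Proof.
move=> x0 x1; rewrite -lnV ?posrE; last lra.
have -> : (1 - x)^-1 = 1 + x / (1 - x) by field; rewrite gt_eqF //; lra.
apply: le_trans (le_ln1Dx _) _; first by apply: lt_le_trans (divr_ge0 _ _); lra.
rewrite ler_pdivrMr; last lra.
have : x * x <= x * (1 / 2) by rewrite ler_wpM2l.
lra.
Qed.

(** The fraction q = 1 - 1 / nu is approximated from below by g / h with an
    error of at most 2 eps.  Unless psi nu is negligible, q is bounded below
    by [q0], so that the error of ln (1 / q) = 1 / psi nu is O(eps / q0), and
    psi nu <= nu <= N1 bounds the resulting error of psi nu. *)
Lemma psi_grid eta N1 : 0 < eta -> 4%:R / eta + 4%:R + eta <= N1 ->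
  exists eps (h : nat), [/\ 0 < eps, eps <= 1 &
  forall nu, 1 < nu -> nu <= N1 -> psi nu <= eta * nu \/
    exists g : nat, [/\ (0 < g)%N, (g < h)%N,
      (1 + eps) * h%:R <= nu * (h%:R - g%:R) &
      psi nu - eta * nu <= (1 - eps) / ln (h%:R / g%:R)]].
Proof.
move=> eta0 hN.
have ieta : 0 < eta^-1 by rewrite invr_gt0.
have N10 : 0 < N1 by lra.
pose q0 := expR (- eta^-1).
have q00 : 0 < q0 by exact: expR_gt0.
have q01 : q0 < 1 by rewrite expR_lt1; lra.
pose eps := eta * q0 / (8%:R * N1).
have e0 : 0 < eps by rewrite divr_gt0 ?mulr_gt0.
have eE : eps * (8%:R * N1) = eta * q0 by rewrite /eps mulfVK // gt_eqF // mulr_gt0.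
have eq0 : 8%:R * eps <= q0.
  rewrite -(ler_pM2r N10); have -> : 8%:R * eps * N1 = eps * (8%:R * N1) by ring.
  by rewrite eE mulrC ler_pM2l //; lra.
have eeta : 32%:R * eps <= eta.
  have : eps * 32%:R <= eps * (8%:R * N1) by rewrite ler_pM2l //; lra.
  rewrite eE; have : eta * q0 <= eta by rewrite ger_pMr //; lra.
  lra.
pose h := (Num.truncn eps^-1).+1.
have hge : eps^-1 < h%:R by exact: truncnS_gt.
have h0 : 0 < h%:R :> R by rewrite ltr0n.
have ih : h%:R^-1 < eps by rewrite invf_plt ?posrE.
exists eps, h; split => //; first lra.
move=> nu nu1 nuN; have [|psin] := leP (psi nu) (eta * nu); [by left|right].
have inu : nu^-1 < 1 by rewrite invf_lt1 //; lra.
have inu0 : 0 < nu^-1 by rewrite invr_gt0; lra.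
pose a := ln (nu / (nu - 1)).
have a0 : 0 < a by exact: ln_ratio_gt0.
have psia : psi nu = a^-1 by [].
pose q := 1 - nu^-1.
have qa : q = expR (- a).
  rewrite expRN lnK ?posrE; last by rewrite divr_gt0; lra.
  by rewrite /q; field; rewrite !gt_eqF //; lra.
have qq0 : q0 < q.
  rewrite qa ltr_expR ltrN2 -ltf_pV2 ?posrE // invrK -psia.
  by apply: lt_trans psin; rewrite ltr_pMr.
have enu : eps * nu^-1 <= eps by rewrite ger_pMr //; lra.
pose g := Num.truncn (h%:R * (q - eps * nu^-1)).
have gle : g%:R <= h%:R * (q - eps * nu^-1).
  by rewrite truncn_le ltW // mulr_gt0 //; move: qq0 enu eq0 e0; clear; lra.
have glt : h%:R * (q - eps * nu^-1) < g%:R + 1 by rewrite natr1 truncnS_gt.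
have gq : q - 2 * eps < g%:R / h%:R.
  rewrite ltr_pdivlMr // mulrC.
  have : h%:R^-1 * h%:R < eps * h%:R by rewrite ltr_pM2r.
  rewrite mulVf ?gt_eqF // => h1.
  have : h%:R * (eps * nu^-1) <= h%:R * eps by rewrite ler_pM2l.
  lra.
pose x := 2 * eps / q0.
have x0 : 0 <= x by rewrite divr_ge0 //; lra.
have xq0 : x * q0 = 2 * eps by rewrite /x mulfVK // gt_eqF.
have x1 : x <= 1 / 2 by rewrite ler_pdivrMr //; lra.
have xq : 2 * eps <= x * q by rewrite -xq0 ler_wpM2l // ltW.
have gh0 : 0 < g%:R / h%:R :> R by lra.
have g0 : (0 < g)%N by rewrite lt0n; apply/eqP => g0; move: gh0; rewrite g0 mul0r ltxx.
have gR : 0 < g%:R :> R by rewrite ltr0n.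
exists g; split => //.
- rewrite -(ltr_nat R); apply: le_lt_trans gle _.
  rewrite gtr_pMr //; have : 0 < eps * nu^-1 by rewrite mulr_gt0.
  rewrite /q; lra.
- have : nu * g%:R <= nu * (h%:R * (q - eps * nu^-1)) by rewrite ler_pM2l //; lra.
  have -> : nu * (h%:R * (q - eps * nu^-1)) = h%:R * (nu - 1 - eps).
    by rewrite /q; field; rewrite gt_eqF //; lra.
  lra.
set lam := ln _.
have q_gt0 : 0 < q := lt_trans q00 qq0.
have x_lt1 : 0 < 1 - x by move: x1; clear; lra.
have lamE : lam = - ln (g%:R / h%:R) by rewrite -lnV ?posrE // invf_div.
have lam_le : lam <= a + 2 * x.
  rewrite lamE lerNl; apply: le_trans (_ : ln (q * (1 - x)) <= _).
    by rewrite lnM ?posrE // qa expRK; move: (neg_ln_le x0 x1); clear; lra.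
  rewrite ler_ln ?posrE // ?mulr_gt0 //; move: gq xq; clear; lra.
have lam0 : 0 < lam.
  rewrite lamE oppr_gt0 ln_lt0 // gh0 /= ltr_pdivrMr // mul1r.
  apply: le_lt_trans gle _.
  rewrite gtr_pMr //; have : 0 < eps * nu^-1 by rewrite mulr_gt0.
  rewrite /q; lra.
apply: le_trans (_ : (1 - eps) / (a + 2 * x) <= _); last first.
  by rewrite ler_pM2l ?lef_pV2 ?posrE //; lra.
rewrite ler_pdivlMr; last lra.
(* After multiplying out, p * a = 1 leaves only error terms. *)
set p := psi nu in psin psia *.
have pn : p <= nu by exact: psi_le.
have p0 : 0 < p by exact: psi_gt0.
have ap : p * a = 1 by rewrite psia mulVf // gt_eqF.
have na : 1 <= nu * a by rewrite -ap ler_pM2r.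
have px : p * (2 * x) <= N1 * (2 * x) by rewrite ler_wpM2r //; lra.
have xN : N1 * (2 * x) * 2 = eta.
  apply: (mulIf (x := q0)); first by rewrite gt_eqF.
  rewrite -eE (_ : N1 * (2 * x) * 2 * q0 = 4%:R * N1 * (x * q0)); last by ring.
  by rewrite xq0; ring.
have en : eta <= eta * (nu * a) by rewrite ler_peMr // ltW.
have nx : 0 <= eta * nu * (2 * x).
  exact: mulr_ge0 (mulr_ge0 (ltW eta0) (ltW (lt_trans ltr01 nu1))) (mulr_ge0 (ler0n _ 2) x0).
by move: ap px xN en nx eeta eta0; clear; lra.
Qed.

(** For large nu, nearly equal blocks of bounded density nu / l lose little
    because nu - 1 <= psi nu <= nu. *)
Lemma psi_blocks eta : 0 < eta ->
  exists eps (h : nat), [/\ 0 < eps, eps <= 1 &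
  forall nu, 1 < nu -> psi nu <= eta * nu \/
    exists l g : nat, [/\ (0 < l)%N, (0 < g)%N, (g < h)%N,
      (1 + eps) * l%:R * h%:R <= nu * (h%:R - g%:R) &
      psi nu - eta * nu <= l%:R * ((1 - eps) / ln (h%:R / g%:R))]].
Proof.
move=> eta0; pose e2 := eta / 2.
have e20 : 0 < e2 by rewrite divr_gt0.
pose N1 := 4%:R / e2 + 4%:R + e2.
have [eps [h [e0 e1 H]]] := psi_grid e20 (lexx N1).
have ie2 : 0 < e2^-1 by rewrite invr_gt0.
exists eps, h; split => // nu nu1.
pose p := N1 / 2.
have p1 : 2 <= p by rewrite /p /N1; lra.
have [l [l0 lnu1 lnuN lpsi]] : exists l : nat, [/\ (0 < l)%N, 1 < nu / l%:R,
    nu / l%:R <= N1 & psi nu <= l%:R * psi (nu / l%:R) + e2 * nu].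
  have [nup|pnu] := ltP nu p.
    exists 1%N; rewrite divr1 mul1r; split => //; first by rewrite /p in nup p1; lra.
    by rewrite lerDl mulr_ge0 //; lra.
  pose l := Num.truncn (nu / p).
  have nup : 1 <= nu / p by rewrite ler_pdivlMr; lra.
  have l0 : (0 < l)%N by rewrite truncn_gt0.
  have lR : 0 < l%:R :> R by rewrite ltr0n.
  have l1 : 1 <= l%:R :> R by rewrite ler1n.
  have lle : l%:R <= nu / p by rewrite truncn_le; lra.
  have llt : nu / p < l%:R + 1 by rewrite natr1 truncnS_gt.
  have lp : l%:R * p <= nu by rewrite -ler_pdivlMr //; lra.
  have lp' : nu < (l%:R + 1) * p by rewrite -ltr_pdivrMr //; lra.
  have lnu : 1 < nu / l%:R by rewrite ltr_pdivlMr //; have : l%:R * 2 <= l%:R * p by [rewrite ler_pM2l]; lra.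
  exists l; split => //.
    rewrite ler_pdivrMr //; have -> : N1 = 2 * p by rewrite /p; lra.
    have : 1 * p <= l%:R * p by rewrite ler_pM2r //; lra.
    lra.
  have := psi_ge lnu; rewrite -(ler_pM2l lR) mulrBr mulrC mulfVK ?gt_eqF // mulr1 => h1.
  have := psi_le nu1 => h2.
  suff : l%:R <= e2 * nu by lra.
  apply: le_trans lle _; rewrite mulrC ler_pM2r; last lra.
  by rewrite -[leRHS]invrK lef_pV2 ?posrE //; rewrite /p /N1; lra.
have lR : 0 < l%:R :> R by rewrite ltr0n.
have lmul : l%:R * (nu / l%:R) = nu by rewrite mulrC mulfVK // gt_eqF.
have [h1|[g [g0 gh h1 h2]]] := H _ lnu1 lnuN.
  left; apply: le_trans lpsi _.
  have : l%:R * psi (nu / l%:R) <= l%:R * (e2 * (nu / l%:R)) by rewrite ler_pM2l.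
  by rewrite mulrCA lmul /e2; lra.
right; exists l, g; split => //.
  move: h1; rewrite -(ler_pM2l lR) [leRHS]mulrA lmul; lra.
move: h2; rewrite -(ler_pM2l lR) mulrBr mulrCA lmul /e2 => h2.
move: lpsi; rewrite /e2; lra.
Qed.

(** * Uniformity and conclusion *)

Lemma M_lower_uniform eps (h : nat) : 0 < eps -> eps <= 1 ->
  exists Y : R, forall g k l n : nat, (0 < g)%N -> (g < h)%N ->
    Y <= ln (ln (k + 1)%:R) -> (0 < l)%N ->
    (1 + eps) * l%:R * (k + 1)%:R * h%:R <= n%:R * (h%:R - g%:R) ->
    l%:R * ((1 - eps) * ln (ln (k + 1)%:R) / ln (h%:R / g%:R) - 2%:R) <= (M n k)%:R.
Proof.
move=> e0 e1.
suff [Y HY] : exists Y : R, forall g, (g < h)%N -> forall k l n : nat, (0 < g)%N ->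
    Y <= ln (ln (k + 1)%:R) -> (0 < l)%N ->
    (1 + eps) * l%:R * (k + 1)%:R * h%:R <= n%:R * (h%:R - g%:R) ->
    l%:R * ((1 - eps) * ln (ln (k + 1)%:R) / ln (h%:R / g%:R) - 2%:R) <= (M n k)%:R.
  by exists Y => g k l n g0 gh; apply: HY.
elim: {1 3}h (leqnn h) => [|j IH] jh; first by exists 0.
have [Y HY] := IH (ltnW jh).
have [->|j0] := posnP j; first by exists 0 => g; rewrite ltnS leqn0 => /eqP->.
have [Y' HY'] := M_lower j0 jh e0 e1.
exists (Num.max Y Y') => g; rewrite ltnS leq_eqVlt => /orP[/eqP->|gj] k l n g0.
  by rewrite ge_max => /andP[_ y]; exact: HY'.
by rewrite ge_max => /andP[y _]; exact: HY.
Qed.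

Lemma iterated_ln_ge (Y : R) : exists K : nat, forall k : nat, (K <= k)%N ->
  Y <= ln (ln (k + 1)%:R).
Proof.
exists (Num.truncn (expR (expR Y))) => k Kk.
have kge : expR (expR Y) <= (k + 1)%:R.
  apply: le_trans (ltW (truncnS_gt _)) _.
  by rewrite ler_nat addn1 ltnS.
have k0 : 0 < (k + 1)%:R :> R by rewrite ltr0n addn1.
have Lge : expR Y <= ln (k + 1)%:R by rewrite -ler_expR lnK.
by rewrite -ler_expR lnK // posrE; apply: lt_le_trans Lge; exact: expR_gt0.
Qed.

End Psi.

Unset Implicit Arguments.

Theorem theorem1p4 (R : realType) (eta : R) (eta_gt0 : 0 < eta) :
  exists K : nat, forall k n : nat, (K <= k)%N -> (k + 1 < n)%N ->
    let nu : R := n%:R / (k + 1)%:R in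
    `| (M n k)%:R / (nu * ln (ln (k + 1)%:R)) - Phi nu | < eta.
Proof.
pose e4 := eta / 4%:R; have e40 : 0 < e4 by rewrite divr_gt0.
have [eps [h [e0 e1 Hpsi]]] := psi_blocks e40.
have [Y1 HY1] := M_lower_uniform h e0 e1.
pose e12 := eta / 12%:R; have e120 : 0 < e12 by rewrite divr_gt0.
pose C := 12%:R + 2 / e12.
have C0 : 12%:R < C by rewrite ltrDl divr_gt0.
pose Y2 := 4%:R * C / eta + 1.
have [K HK] := iterated_ln_ge (Num.max Y1 Y2).
exists K => k n Kk kn /=; set nu : R := n%:R / (k + 1)%:R; set y := ln (ln _).
have := HK k Kk; rewrite ge_max -/y => /andP[yY1 yY2].
have Y20 : 0 < 4%:R * C / eta by rewrite divr_gt0 //; lra.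
have y0 : 0 < y by rewrite /Y2 in yY2; lra.
have d0 : 0 < (k + 1)%:R :> R by rewrite ltr0n addn1.
have nu1 : 1 < nu by rewrite ltr_pdivlMr // mul1r ltr_nat.
have Cy : 4%:R * C < eta * y.
  by rewrite [ltRHS]mulrC -ltr_pdivrMr //; apply: lt_le_trans yY2; rewrite /Y2 ltrDl.
have nCy : 4%:R * (nu * C) < nu * y * eta.
  rewrite (_ : 4%:R * _ = nu * (4%:R * C)); last by ring.
  rewrite -mulrA ltr_pM2l; last lra.
  by rewrite mulrC in Cy *; rewrite mulrC; lra.
have ny0 : 0 < nu * y by rewrite mulr_gt0 //; lra.
have nye0 : 0 < nu * y * eta by exact: mulr_gt0.
have PhiE : Phi nu = psi nu * y / (nu * y).
  have a0 := ln_ratio_gt0 nu1.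
  rewrite /Phi /psi; field; rewrite !gt_eqF //; lra.
rewrite PhiE -mulrBl normrM (gtr0_norm (x := (nu * y)^-1)) ?invr_gt0 //.
rewrite ltr_pdivrMr // ltr_norml.
apply/andP; split; last first.
  have := M_upper e120 kn y0; rewrite -/nu -/y -/C.
  rewrite -addrA -/C mulrDr.
  have -> : nu * (3%:R * e12 * y) = nu * y * eta / 4%:R by rewrite /e12; field.
  by move: nCy nye0; clear; lra.
have M0 : 0 <= (M n k)%:R :> R by [].
have nC : 12%:R * nu < nu * C by rewrite mulrC ltr_pM2l //; lra.
have [hp|[l [g [l0 g0 gh h1 h2]]]] := Hpsi nu nu1.
  have : psi nu * y <= e4 * nu * y by rewrite ler_pM2r.
  rewrite (_ : e4 * nu * y = nu * y * eta / 4%:R); last by rewrite /e4; field.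
  by move: nye0 M0; clear; lra.
have lR : 0 < l%:R :> R by rewrite ltr0n.
have lnu : l%:R <= nu.
  have hR : 0 < h%:R :> R by rewrite ltr0n (leq_trans g0) // ltnW.
  rewrite -(ler_pM2r hR); apply: le_trans (_ : (1 + eps) * l%:R * h%:R <= _).
    by rewrite ler_pM2r // ler_peMl //; lra.
  apply: le_trans h1 _; rewrite ler_pM2l; last lra.
  by rewrite gerBl.
have := HY1 g k l n g0 gh yY1 l0.
have -> : (1 + eps) * l%:R * (k + 1)%:R * h%:R = (1 + eps) * l%:R * h%:R * (k + 1)%:R.
  by ring.
have -> : n%:R * (h%:R - g%:R) = nu * (h%:R - g%:R) * (k + 1)%:R.
  by rewrite mulrAC mulfVK ?gt_eqF.
rewrite ler_pM2r // -/y => /(_ h1) h3.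
have : (psi nu - e4 * nu) * y <= l%:R * ((1 - eps) / ln (h%:R / g%:R)) * y.
  by rewrite ler_pM2r.
rewrite (_ : l%:R * _ * y = l%:R * ((1 - eps) * y / ln (h%:R / g%:R))); last by ring.
rewrite mulrBl (_ : e4 * nu * y = nu * y * eta / 4%:R); last by rewrite /e4; field.
by move: h3 lnu nye0 nCy nC; rewrite mulrBr; clear; lra.
Qed.
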